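(* Let $\kappa$ be a regular uncountable cardinal and $(\lambda_i)_{i\in\kappa}$ a transfinite sequence of cardinals with $1<\lambda_i<\kappa$. The space $X=\bigodot_{i\in\kappa}\lambda_i$ has the following properties: (1) for each open cover $\mathcal V$ of $X$ there exists an ordinal $\alpha\in\kappa$ such that for each $x\in X$ the set $U_\alpha[x]=\{y\in X:y|\alpha=x|\alpha\}$ is contained in some set $V\in\mathcal V$; (2) the space $X$ is paracompact and the universal uniformity $\mathcal U_X$ of $X$ is generated by the base consisting of the sets $U_\alpha=\{(x,y)\in X\times X:x|\alpha=y|\alpha\}$, where $\alpha\in\kappa$; (3) $\mathcal U_X\cong\kappa\cong\mathcal T_x(X)$ for all $x\in X$; (4) $p\mathcal U_X\cong\kappa^\kappa\cong q\mathcal U_X$.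
   Context: $\bigodot_{i\in\kappa}\lambda_i=\{x\in\prod_{i\in\kappa}\lambda_i:|\{i\in\kappa:x(i)\ne0\}|<\omega\}$, endowed with the topology generated by the base consisting of the sets $\{y\in\bigodot_{i\in\kappa}\lambda_i:y|\alpha=x|\alpha\}$, $x\in\bigodot_{i\in\kappa}\lambda_i$, $\alpha\in\kappa$. Here ordinals $\alpha\in\kappa$ are identified with $\{\beta:\beta<\alpha\}$ and $x|\alpha$ is the restriction of $x$ to $\alpha$. For posets $P,Q$ (non-empty sets with a reflexive transitive relation) write $P\succcurlyeq Q$ if there is a monotone map $f:P\to Q$ with cofinal image (for each $q\in Q$ there is $p\in P$ with $q\le f(p)$); $P\cong Q$ means $P\succcurlyeq Q$ and $Q\succcurlyeq P$. The cardinal $\kappa$ is a poset under its well-order; $\kappa^\kappa$ is the set of functions $\kappa\to\kappa$ with the pointwise order. $\mathcal T_x(X)$ is the set of all neighborhoods of $x$; it and the families $p\mathcal U_X,q\mathcal U_X,\mathcal U_X$ are posets under reverse inclusion ($U\le V$ iff $V\subset U$). $p\mathcal U_X$ is the family of all neighborhood assignments, i.e. sets $U\subset X\times X$ such that for each $x$ the set $U[x]=\{y:(x,y)\in U\}$ is a neighborhood of $x$. The universal quasi-uniformity $q\mathcal U_X$ is the filter on $X\times X$ with base consisting of the sets $\bigcup_{n\in\omega}\bigcup_{\sigma\in S_n}U_{\sigma(0)}\cdots U_{\sigma(n-1)}$, where $(U_n)_{n\in\omega}\in(p\mathcal U_X)^\omega$, $S_n$ is the group of permutations of $\{0,\dots,n-1\}$,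 and products are compositions of relations: $UV=\{(x,z):\exists y\ (x,y)\in U,\ (y,z)\in V\}$. The universal uniformity $\mathcal U_X$ is the uniformity with base $\{(x,y):d(x,y)<1\}$, $d$ running over all continuous pseudometrics on $X$. *)

(* Defs.v *)
From HB Require Import structures.
From mathcomp Require Import all_boot all_order perm all_algebra.
From mathcomp Require Import all_classical all_reals all_analysis.
From mathcomp Require wochoice.
Import Order.TTheory GRing.Theory Num.Theory.
Import numFieldNormedType.Exports.

Set Implicit Arguments.
Unset Strict Implicit.
Unset Printing Implicit Defensive.

Local Open Scope classical_set_scope.
Local Open Scope card_scope.
Local Open Scope order_scope.

(* A non-zero ordinal is a well-ordered type K with least element \bot; an
   element a of K is the ordinal {b | b < a}, which is [seg a]. *)

Section Cardinals.
Context {d : Order.disp_t} {K : bOrderType d}.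

Definition seg (a : K) : set K := [set b | b < a].

Definition is_cardinal (a : K) : Prop :=
  forall b, b < a -> ~~ (seg a #<= seg b).

Definition cofinal (A : set K) : Prop :=
  forall a, exists2 b, A b & a <= b.

End Cardinals.

(* K is an infinite initial ordinal equal to its own cofinality. *)
Definition regular_cardinal d (K : bOrderType d) : Prop :=
  [/\ wochoice.well_order (<=%O : rel K),
      infinite_set [set: K],
      forall a : K, ~~ ([set: K] #<= seg a) &
      forall A : set K, cofinal A -> [set: K] #<= A].

Section Domination.
Context {d1 d2 : Order.disp_t}.

Definition dominates (P : preorderType d1) (Q : preorderType d2) : Prop :=
  exists2 f : P -> Q, {homo f : p p' / p <= p'} & forall q, exists p, q <= f p.

End Domination.

Definition poset_equiv d1 d2 (P : preorderType d1) (Q : preorderType d2) :=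
  dominates P Q /\ dominates Q P.

(* A family of sets, preordered by reverse inclusion. *)
Section ReverseInclusion.
Context {T : Type}.

Definition revincl (F : set (set T)) : Type := set_type F.

Context (F : set (set T)).

HB.instance Definition _ := Choice.on (revincl F).

Definition revincl_le (U V : revincl F) : bool := `[< val V `<=` val U >].

Lemma revincl_le_refl : reflexive revincl_le.
Proof. by move=> U; apply/asboolP. Qed.

Lemma revincl_le_trans : transitive revincl_le.
Proof.
move=> V U W /asboolP VU /asboolP WV; apply/asboolP.
exact: subset_trans WV VU.
Qed.

Fact revincl_display : Order.disp_t. Proof. exact: Order.default_display. Qed.

HB.instance Definition _ := Order.Le_isPreorder.Build revincl_display
  (revincl F) revincl_le_refl revincl_le_trans.

End ReverseInclusion.

Section Topology.
Context {T : topologicalType}.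

Definition open_cover (V : set (set T)) : Prop :=
  V `<=` open /\ \bigcup_(A in V) A = setT.

Definition refines (W V : set (set T)) : Prop :=
  forall A, W A -> exists2 B, V B & A `<=` B.

Definition locally_finite (W : set (set T)) : Prop :=
  forall x : T, exists2 N, nbhs x N & finite_set [set A | W A /\ A `&` N !=set0].

End Topology.

Definition paracompact (T : topologicalType) : Prop :=
  hausdorff_space T /\
  forall V : set (set T), open_cover V ->
    exists W : set (set T), [/\ open_cover W, refines W V & locally_finite W].

Definition nbhd_assignments (T : topologicalType) : set (set (T * T)) :=
  [set U | forall x, nbhs x (xsection U x)].

Arguments nbhd_assignments T : clear implicits.

(* Left-to-right composition: the library's [V \; U] first goes along U. *)
Definition relcomp {T : Type} (U V : set (T * T)) : set (T * T) :=
  (V \; U)%relation.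

(* For n = 0 the composition is the diagonal. *)
Definition perm_product {T : Type} (U : nat -> set (T * T)) : set (T * T) :=
  \bigcup_n \bigcup_(s : 'S_n) \big[relcomp/diagonal]_(i < n) U (s i).

Definition universal_quasi_uniformity (T : topologicalType) :
    set (set (T * T)) :=
  filter_from [set U : nat -> set (T * T) | forall n, nbhd_assignments T (U n)]
    perm_product.

Arguments universal_quasi_uniformity T : clear implicits.

Section UniversalUniformity.
Local Open Scope ring_scope.

Definition is_pseudometric (R : realType) (T : Type) (d : T -> T -> R) : Prop :=
  [/\ forall x y, 0 <= d x y, forall x, d x x = 0,
      forall x y, d x y = d y x & forall x y z, d x z <= d x y + d y z].

Definition universal_uniformity (R : realType) (T : topologicalType) :
    set (set (T * T)) :=
  filter_from
    [set d : T -> T -> R | is_pseudometric d /\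
                           continuous (fun p : T * T => d p.1 p.2)]
    (fun d => [set p | d p.1 p.2 < 1]).

End UniversalUniformity.

Arguments universal_uniformity R T : clear implicits.

Section Bigodot.
Context {d : Order.disp_t} {K : bOrderType d}.

Definition bigodot_set (lam : K -> K) : set (K -> K) :=
  [set x | (forall i, x i \in seg (lam i)) /\
           finite_set [set i | x i != \bot]].

Definition bigodot (lam : K -> K) : Type := set_type (bigodot_set lam).

Context (lam : K -> K).

HB.instance Definition _ := Choice.on (bigodot lam).

Definition bigodot_fun (x : bigodot lam) : K -> K := val x.

Definition agree (a : K) : set (bigodot lam * bigodot lam) :=
  [set p | {in seg a, bigodot_fun p.1 =1 bigodot_fun p.2}].

Definition bigodot_base : set (set (bigodot lam)) :=
  [set A | exists (x : bigodot lam) (a : K),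
    A = [set y | {in seg a, bigodot_fun y =1 bigodot_fun x}]].

Lemma bigodot_base_cover : \bigcup_(A in bigodot_base) A = setT.
Proof.
apply/seteqP; split => // x _.
exists [set y | {in seg \bot, bigodot_fun y =1 bigodot_fun x}].
  by exists x, \bot.
by [].
Qed.

Lemma bigodot_base_join (A B : set (bigodot lam)) t :
  bigodot_base A -> bigodot_base B -> A t -> B t ->
  exists C, [/\ bigodot_base C, C t & C `<=` A `&` B].
Proof.
move=> [x [a ->]] [y [b ->]] /= tx ty.
exists [set z | {in seg (Order.max a b), bigodot_fun z =1 bigodot_fun t}].
split; [by exists t, (Order.max a b) | by [] |] => z /= zt.
split=> c; rewrite inE /seg /= => cm.
  by rewrite zt ?tx ?inE // /seg /= lt_max cm.
by rewrite zt ?ty ?inE // /seg /= lt_max cm orbT.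
Qed.

HB.instance Definition _ := isBaseTopological.Build (bigodot lam)
  bigodot_base_cover bigodot_base_join.

End Bigodot.

Arguments agree {d K} lam a.

(* Main.v *)
Require Import Defs.
From mathcomp Require Import all_boot all_order all_algebra.
From mathcomp Require Import all_classical all_reals all_analysis.
Import Order.TTheory GRing.Theory Num.Theory.
Import numFieldNormedType.Exports.

Set Implicit Arguments.
Unset Strict Implicit.
Unset Printing Implicit Defensive.

(** Call a set small when every map from it to K is bounded. By regularity every
set of cardinality less than K is small, and small unions of small sets are
small; since K is uncountable, countable sets are small. The set [supp_below a]
of the points supported below a is small: such a point is coded by a finite
list of pairs (i, v) with i < a and v < lam i ([small_supp_below]).

Call [xsection (agree lam a) x] the ball of radius a about x; these balls are a
neighborhood base, and a larger radius gives a smaller ball. The heart of the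
theorem is a closing-off argument ([uniform_refinement]). Pick for each point x
an index g x such that the ball of radius g x about x lies in the prescribed
neighborhood of x. Smallness bounds g on each [supp_below b], so countably many
steps lead to an index a, the supremum of a sequence s, such that g is bounded
by s (n + 1) on [supp_below (s n)]. A point x has finite support, so below a it
is indistinguishable from a truncation z supported below some s n, and the ball
of radius a about x is inside the ball of radius g z about z. Hence one index
serves all points. This refines open covers; it gives paracompactness because
the balls of a fixed radius partition X into open sets; and applied to the balls
of radius 1/2 of a continuous pseudometric it shows that the sets [agree lam a]
are a base of the universal uniformity.

The universal uniformity and the neighborhood filters are equivalent to K
because both have a strictly decreasing base indexed by K: a filter element is
sent to the least index of a basic set inside it, and an index to its basic set.

Finally K^K, the neighborhood assignments and the universal quasi-uniformity
dominate each other in a cycle.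
- K^K dominates the assignments: rank the points so that those of bounded rank
  form a small set, and let f choose the radius at x from the rank of x; the
  radii that an assignment needs at the points of rank at most a are bounded, so
  some f majorizes them.
- The assignments dominate the quasi-uniformity by N |-> the union of the powers
  of N, because a countable family of assignments has an assignment as its
  intersection.
- The quasi-uniformity dominates K^K: read off the radius at points e_i whose
  first nonzero coordinate is i. The balls of radii h i > i about the e_i are
  disjoint, so there is a transitive assignment that equals these balls at the
  e_i; its powers add nothing, so arbitrary functions are majorized. *)

Local Open Scope classical_set_scope.
Local Open Scope order_scope.

(** * Domination between families of sets *)

Section ReverseInclusionMaps.

Lemma dominates_trans d1 d2 d3 (P : preorderType d1) (Q : preorderType d2)
    (S : preorderType d3) :
  dominates P Q -> dominates Q S -> dominates P S.
Proof.
move=> [f f_homo f_cof] [g g_homo g_cof].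
exists (g \o f) => [p p' pp'|s] /=; first exact/g_homo/f_homo.
have [q sq] := g_cof s; have [p qp] := f_cof q.
by exists p; apply: le_trans sq _; exact: g_homo.
Qed.

Lemma poset_equiv_sym d1 d2 (P : preorderType d1) (Q : preorderType d2) :
  poset_equiv P Q -> poset_equiv Q P.
Proof. by case. Qed.

Lemma dominates_to_revincl d (P : preorderType d) (T : Type)
    (F : set (set T)) (phi : P -> set T) :
  (forall p, F (phi p)) ->
  (forall p p', p <= p' -> phi p' `<=` phi p) ->
  (forall U, F U -> exists p, phi p `<=` U) ->
  dominates P (revincl F).
Proof.
move=> Fphi phi_homo phi_cof.
exists (fun p => exist _ (phi p) (mem_set (Fphi p)) : revincl F).
  by move=> p p' pp'; apply/asboolP; exact: phi_homo.
move=> [U FU]; have [p pU] := phi_cof _ (set_mem FU).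
by exists p; apply/asboolP.
Qed.

Lemma dominates_from_revincl d (Q : preorderType d) (T : Type)
    (F : set (set T)) (psi : set T -> Q) :
  (forall U V, F U -> F V -> V `<=` U -> psi U <= psi V) ->
  (forall q, exists2 U, F U & q <= psi U) ->
  dominates (revincl F) Q.
Proof.
move=> psi_homo psi_cof; exists (fun U : revincl F => psi (val U)).
  move=> [U FU] [V FV] /asboolP /= VU.
  by apply: psi_homo => //; exact: set_mem.
move=> q; have [U FU qU] := psi_cof q.
by exists (exist _ U (mem_set FU) : revincl F).
Qed.

End ReverseInclusionMaps.

(** * Permuted compositions of relations *)

Section PermProduct.
Context {T : Type}.
Implicit Types (U V : nat -> set (T * T)) (E : set (T * T)).

Lemma sub_perm_product U V :
  (forall n, U n `<=` V n) -> perm_product U `<=` perm_product V.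
Proof.
move=> UV p [n _ [s _ Up]]; exists n => //; exists s => //.
apply: (big_ind2 (fun A B : set (T * T) => A `<=` B)) p Up => //.
by move=> A A' B B' AA' BB' [x z] [y /AA' ? /BB' ?]; exists y.
Qed.

(** The term for n = 1. *)
Lemma perm_product_sub0 U : U 0%N `<=` perm_product U.
Proof.
move=> [x y] Uxy; exists 1%N => //; exists (perm.perm_one _) => //.
by rewrite big_ord_recl big_ord0 ord1; exists y.
Qed.

(** A preorder absorbs compositions with itself; this is how an element of the
universal quasi-uniformity can be kept under control. *)
Lemma perm_product_preorder E :
  diagonal `<=` E -> relcomp E E `<=` E -> perm_product (fun=> E) `<=` E.
Proof.
move=> diagE EE p [n _ [s _ Ep]].
apply: (big_ind (fun A => A `<=` E)) p Ep => [//|A B AE BE [x z]|_ _ p];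
  last by [].
by move=> [y /AE xy /BE yz]; apply: EE; exists y.
Qed.

End PermProduct.

(** * Small sets and regular cardinals *)

Section SmallSets.
Context {d : Order.disp_t} {K : bOrderType d}.

(** Smallness stands in for having cardinality less than K: stated through
bounds, it turns closure under small unions into a nested supremum and avoids
cardinal arithmetic. *)
Definition small {T : Type} (A : set T) : Prop :=
  forall f : T -> K, exists b, forall x, A x -> f x <= b.

Lemma sub_small {T} (A B : set T) : A `<=` B -> small B -> small A.
Proof. by move=> AB Bsm f; have [b fb] := Bsm f; exists b => x /AB/fb. Qed.

Lemma small_image {T T'} (g : T -> T') (A : set T) :
  small A -> small (g @` A).
Proof.
by move=> Asm f; have [b fb] := Asm (f \o g); exists b => _ [x /fb ? <-].
Qed.

Lemma small_subsingleton {T} (A : set T) :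
  (forall x y, A x -> A y -> x = y) -> small A.
Proof.
move=> A1 f; have [[x Ax]|A0] := pselect (A !=set0).
  by exists (f x) => y /(A1 _ _ Ax) <-.
by exists \bot => x Ax; case: A0; exists x.
Qed.

Lemma small_bigcup {I T} (D : set I) (F : I -> set T) :
  small D -> (forall i, D i -> small (F i)) -> small (\bigcup_(i in D) F i).
Proof.
move=> Dsm Fsm f.
have /choice[g gP] i : exists b, D i -> forall x, F i x -> f x <= b.
  have [/Fsm/(_ f)[b fb]|nDi] := pselect (D i); first by exists b.
  by exists \bot.
have [b gb] := Dsm g; exists b => x [i Di Fx].
exact: le_trans (gP _ Di _ Fx) (gb _ Di).
Qed.

End SmallSets.
Arguments small {d} K {T} A.

Section Regular.
Context {d : Order.disp_t} {K : bOrderType d}.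
Hypothesis K_regular : regular_cardinal K.
Hypothesis K_uncountable : ~ countable [set: K].

Lemma well_order_least (P : set K) : P !=set0 ->
  exists2 m, P m & forall b, P b -> m <= b.
Proof.
move=> [x Px]; have [Kwo _ _ _] := K_regular.
have [|m [[/set_mem Pm m_min] _]] := Kwo (mem P).
  by exists x; exact: mem_set.
by exists m => // b Pb; apply: m_min; exact: mem_set.
Qed.

Definition least (P : set K) : K :=
  xget \bot [set m | P m /\ forall b, P b -> m <= b].

Lemma least_mem P : P !=set0 -> P (least P).
Proof.
move=> /well_order_least[m Pm mP]; rewrite /least.
by case: xgetP => [y _ []//|/(_ m)[]].
Qed.

Lemma least_le P b : P b -> least P <= b.
Proof.
move=> Pb; have /well_order_least[m Pm mP] : P !=set0 by exists b.
by rewrite /least; case: xgetP => [y _ [_ yP]|/(_ m)[]//]; exact: yP.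
Qed.

Lemma le_least P Q : Q !=set0 -> Q `<=` P -> least P <= least Q.
Proof. by move=> Q0 QP; apply: least_le; apply: QP; exact: least_mem. Qed.

(** An unbounded map has a cofinal image, which regularity makes as large as
K. *)
Lemma small_card {T} (A : set T) : ~ ([set: K] #<= A)%card -> small K A.
Proof.
have [_ _ _ reg] := K_regular.
move=> nKA f; apply: contrapT => unbdd; apply: nKA.
apply: card_le_trans (card_image_le f A); apply: reg => b.
apply: contrapT => nb; apply: unbdd; exists b => x Ax.
rewrite leNgt; apply/negP => /ltW bfx; apply: nb.
by exists (f x) => //; exists x.
Qed.

Lemma small_seg (a : K) : small K (seg a).
Proof. by have [_ _ Kseg _] := K_regular; apply/small_card/negP. Qed.

Lemma small_countable {T} (A : set T) : countable A -> small K A.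
Proof. by move=> Ac; apply: small_card => /sub_countable/(_ Ac). Qed.

Lemma exists_gt (a : K) : exists b, a < b.
Proof.
apply: contrapT => amax; apply: K_uncountable.
have [_ _ _ reg] := K_regular.
apply: (sub_countable (reg [set a] _) (countable1 _)) => b; exists a => //.
by rewrite leNgt; apply/negP => ab; apply: amax; exists b.
Qed.

(** The lists of length n + 1 are a small union of images of those of length n,
and there are countably many lengths. *)
Lemma small_seqs {T : choiceType} (A : set T) :
  small K A -> small K [set s : seq T | {in s, forall x, A x}].
Proof.
move=> Asm.
apply: (@sub_small _ _ _ _
  (\bigcup_n [set s : seq T | size s = n /\ {in s, forall x, A x}])).
  by move=> s sA; exists (size s).
apply: small_bigcup => [|n _]; first exact: small_countable.
elim: n => [|n IHn].
  by apply: small_subsingleton => s t [/size0nil-> _] [/size0nil-> _].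
apply: sub_small (small_bigcup (F := fun x => cons x @`
  [set s : seq T | size s = n /\ {in s, forall x, A x}]) Asm _).
  case=> [[]//|x s [/= [ss]] sA]; exists x.
    by apply: sA; rewrite inE eqxx.
  by exists s => //; split=> // y ys; apply: sA; rewrite inE ys orbT.
by move=> x _; exact: small_image.
Qed.

(** One direction sends an index to its basic set; the other sends U to the
least index of a basic set inside U, and strictness makes the latter map recover
the index of a basic set. *)
Lemma poset_equiv_filter_base {T} (B : K -> set T) :
  (forall a b, a <= b -> B b `<=` B a) ->
  (forall a b, a < b -> ~ B a `<=` B b) ->
  poset_equiv (revincl (filter_from setT B)) K.
Proof.
move=> Bhomo Bstrict; split; last first.
  by apply: (@dominates_to_revincl _ K _ _ B) => // [a|U [a _ BU]]; exists a.
apply: (@dominates_from_revincl _ K _ _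
  (fun U => least [set a | B a `<=` U])) => [U V [a _ aU] [b _ bV] VU|q].
  by apply: le_least => [|c /= cV]; [exists b|exact: subset_trans VU].
exists (B q); first by exists q.
rewrite leNgt; apply/negP => /Bstrict; apply.
by apply: (@least_mem [set a | B a `<=` B q]); exists q => /=.
Qed.

(** * Points and neighborhoods *)

Section Bigodot.
Context (lam : K -> K).
Hypothesis lam_gt1 : forall i, [set \bot] `<` seg (lam i).

Local Notation X := (bigodot lam).
Local Notation U := (agree lam).
Implicit Types (x y z : X) (a b c i : K).

Lemma bigodot_inj x y : bigodot_fun x =1 bigodot_fun y -> x = y.
Proof. by move=> xy; apply: val_inj; apply/funext. Qed.

Lemma bigodot_lt x i : bigodot_fun x i < lam i.
Proof. by have [/(_ i) /set_mem] := set_mem (valP x). Qed.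

Lemma finite_supp x : finite_set [set i | bigodot_fun x i != \bot].
Proof. by have [] := set_mem (valP x). Qed.

Lemma bigodot_intro (f : K -> K) : (forall i, f i < lam i) ->
  finite_set [set i | f i != \bot] -> exists x, bigodot_fun x = f.
Proof.
move=> flam fsupp.
have /mem_set fX : bigodot_set lam f by split=> [i|//]; apply/mem_set/flam.
by exists (exist _ f fX : X).
Qed.

Lemma lam_gt0 i : \bot < lam i.
Proof. by have [+ _] := lam_gt1 i; apply. Qed.

Lemma exists_nonzero i : exists2 v, v < lam i & v != \bot.
Proof.
have [_ /nonsubset[v [vlam v0]]] := lam_gt1 i; exists v => //.
by apply/eqP => /v0.
Qed.

Lemma bigodot_update x i v : v < lam i ->
  exists y, bigodot_fun y = fun j => if j == i then v else bigodot_fun x j.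
Proof.
move=> vi; apply: bigodot_intro => [j|].
  by case: (eqVneq j i) => [->|_] //; exact: bigodot_lt.
apply: (@sub_finite_set _ _ ([set i] `|` [set j | bigodot_fun x j != \bot])).
  by move=> j /=; case: (eqVneq j i) => [->|_ ?]; [left|right].
by rewrite finite_setU; split; [exact: finite_set1|exact: finite_supp].
Qed.

Lemma exists_zero : exists x, bigodot_fun x = fun=> \bot.
Proof.
apply: bigodot_intro => [i|]; first exact: lam_gt0.
by rewrite (_ : mkset _ = set0) // -subset0 => i /=; rewrite eqxx.
Qed.

Lemma bigodot_truncate x a :
  exists y, bigodot_fun y = fun i => if i < a then bigodot_fun x i else \bot.
Proof.
apply: bigodot_intro => [i|].
  by case: ifP => _; [exact: bigodot_lt|exact: lam_gt0].
apply: sub_finite_set (finite_supp x) => i /=.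
by case: ifP => // _; rewrite eqxx.
Qed.

Lemma agreeP a x y :
  U a (x, y) <-> forall i, i < a -> bigodot_fun x i = bigodot_fun y i.
Proof.
by split=> [xy i ia|xy i /set_mem ia]; apply: xy => //; exact: mem_set.
Qed.

Lemma agree_refl a x : U a (x, x).
Proof. exact/agreeP. Qed.

Lemma agree_sym a x y : U a (x, y) -> U a (y, x).
Proof. by move=> /agreeP xy; apply/agreeP => i /xy. Qed.

Lemma agree_trans a y x z : U a (x, y) -> U a (y, z) -> U a (x, z).
Proof.
by move=> /agreeP xy /agreeP yz; apply/agreeP => i ia; rewrite xy ?yz.
Qed.

Lemma le_agree a b : a <= b -> U b `<=` U a.
Proof.
move=> ab [x y] /agreeP xy; apply/agreeP => i ia; apply: xy.
exact: lt_le_trans ab.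
Qed.

(** Changing the coordinate a of x is enough, since every coordinate has at
least two values. *)
Lemma agree_strict a b x : a < b -> exists2 y, U a (x, y) & ~ U b (x, y).
Proof.
move=> ab.
have [v vlam vx] : exists2 v, v < lam a & v != bigodot_fun x a.
  have [->|x0] := eqVneq (bigodot_fun x a) \bot; first exact: exists_nonzero.
  by exists \bot; [exact: lam_gt0|rewrite eq_sym].
have [y yE] := bigodot_update x vlam; exists y.
  by apply/agreeP => i ia; rewrite yE lt_eqF.
by move=> /agreeP/(_ _ ab); rewrite yE eqxx => /esym/eqP; rewrite (negPf vx).
Qed.

Lemma nbhs_agree x : nbhs x = filter_from setT (fun a => xsection (U a) x).
Proof.
apply/seteqP; split => A.
  rewrite nbhsE => -[B [[D DB <-] [C DC Cx]] BA].
  have [z [a CE]] := DB _ DC; exists a => //.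
  move: Cx; rewrite /= CE => xz y /xsectionP/agreeP xy.
  apply: BA; exists C => //; rewrite CE => i /= /[dup] ia /xz <-.
  by rewrite xy //; exact: set_mem.
move=> [a _ aA]; rewrite nbhsE; exists (xsection (U a) x) => //; split.
  exists [set xsection (U a) x]; last by rewrite bigcup_set1.
  move=> _ ->; exists x, a; apply/seteqP; split=> y.
    by move=> /xsectionP/agreeP xy i /set_mem/xy.
  by move=> yx; apply/xsectionP/agreeP => i ia; rewrite yx //; exact: mem_set.
exact/xsectionP/agree_refl.
Qed.

Lemma nbhs_section a x : nbhs x (xsection (U a) x).
Proof. by rewrite nbhs_agree; exists a. Qed.

(** Countably many radii are bounded, K being regular and uncountable. *)
Lemma nbhs_bigcap x (F : nat -> set X) :
  (forall n, nbhs x (F n)) -> nbhs x (\bigcap_n F n).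
Proof.
move=> Fx.
have /choice[f fF] n : exists a, xsection (U a) x `<=` F n.
  by have := Fx n; rewrite nbhs_agree => -[a _ aF]; exists a.
have [b fb] := small_countable (countableP [set: nat]) f.
rewrite nbhs_agree; exists b => // y /xsectionP xy n _.
by apply/fF/xsectionP/(le_agree (fb n I)).
Qed.

(** * Uniform refinement and the universal uniformity *)

Definition supp_below a : set X :=
  [set x | forall i, a <= i -> bigodot_fun x i = \bot].

Lemma exists_supp_below x : exists a, supp_below a x.
Proof.
have [b xb] := small_countable (finite_set_countable (finite_supp x)) id.
have [a ba] := exists_gt b; exists a => i ai; apply/eqP/negPn/negP => /xb.
by rewrite leNgt (lt_le_trans ba).
Qed.

(** A point with finite support is determined by the finite list of its nonzero
coordinates with their values, and these lists form a small set. *)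
Lemma small_supp_below a : small K (supp_below a).
Proof.
pose E := \bigcup_(i in seg a) (pair i @` seg (lam i)).
pose coded (s : seq (K * K)) : set X := [set x |
  forall i v, v != \bot -> ((i, v) \in s) = (bigodot_fun x i == v)].
apply: (@sub_small _ _ _ _
  (\bigcup_(s in [set s : seq (K * K) | {in s, forall p, E p}]) coded s)).
  move=> x xa; have /finite_seqP[t tE] := finite_supp x.
  have tP i : (i \in t) = (bigodot_fun x i != \bot).
    by have /(congr1 (@^~ i)) /= := tE => /propeqP => H; apply/idP/idP => /H.
  exists [seq (i, bigodot_fun x i) | i <- t].
    move=> _ /mapP[i ti ->]; exists i; last first.
      by exists (bigodot_fun x i) => //; exact: bigodot_lt.
    rewrite /seg/= ltNge; apply/negP => /xa xi0.
    by move: ti; rewrite tP xi0 eqxx.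
  move=> i v v0; apply/mapP/eqP => [[j tj [-> ->//]]|xiv].
  by exists i; rewrite ?tP xiv.
apply: small_bigcup => [|s _].
  apply: small_seqs; apply: small_bigcup => [|i _]; first exact: small_seg.
  exact/small_image/small_seg.
have coded_eq x y : coded s x -> coded s y ->
    forall i, bigodot_fun x i != \bot -> bigodot_fun y i = bigodot_fun x i.
  by move=> xs ys i xi; apply/eqP; rewrite -ys // xs.
apply: small_subsingleton => x y xs ys; apply: bigodot_inj => i.
have [xi0|/(coded_eq _ _ xs ys)->//] := eqVneq (bigodot_fun x i) \bot.
have [->//|/(coded_eq _ _ ys xs)//] := eqVneq (bigodot_fun y i) \bot.
Qed.

Lemma supp_below_bound (g : X -> K) :
  exists f : K -> K, forall a x, supp_below a x -> g x <= f a.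
Proof. by have /choice[f fP] := small_supp_below ^~ g; exists f. Qed.

(** Closing off under a bound for the radii: the supremum a of countably many
steps is good for every x, because below a the finite support of x is exhausted
after finitely many steps. The center z is the truncation of x at that step. *)
Lemma uniform_refinement (N : X -> set X) : (forall x, nbhs x (N x)) ->
  exists a, forall x, exists z, xsection (U a) x `<=` N z.
Proof.
move=> Nx.
have /choice[g gN] x : exists a, xsection (U a) x `<=` N x.
  by have := Nx x; rewrite nbhs_agree => -[a _ aN]; exists a.
have [f gf] := supp_below_bound g.
(* The maximum keeps s nondecreasing, which finite supports need. *)
pose s n := iter n (fun a => Order.max a (f a)) \bot.
have s_homo m n : (m <= n)%N -> s m <= s n.
  apply: (@homo_leq _ s <=%O) => [||k]; [exact: lexx|exact: le_trans|].
  by rewrite /= le_max lexx.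
pose ub := [set a | forall n, s n <= a].
have ub0 : ub !=set0.
  have [b sb] := small_countable (countableP [set: nat]) s.
  by exists b => n; exact: sb.
pose a := least ub.
have s_le n : s n <= a by exact: (least_mem ub0).
have lt_s i : i < a -> exists n, i < s n.
  move=> ia; apply: contrapT => si.
  have : a <= i.
    apply: (@least_le ub) => n; rewrite leNgt.
    by apply/negP => ?; apply: si; exists n.
  by rewrite leNgt ia.
exists a => x.
have [n xn] : exists n, forall i, i < a -> bigodot_fun x i != \bot -> i < s n.
  have /finite_seqP[t tE] := finite_supp x.
  have [n tn] : exists n, {in t, forall i, i < a -> i < s n}.
    elim: t {tE} => [|j t [n tn]]; first by exists 0%N.
    have [m jm] : exists m, j < a -> j < s m.
      by have [/lt_s[m ?]|_] := boolP (j < a); [exists m|exists 0%N].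
    exists (maxn m n) => i; rewrite inE => /orP[/eqP->|/tn in_] ia.
      by apply: lt_le_trans (jm ia) _; apply: s_homo; rewrite leq_maxl.
    by apply: lt_le_trans (in_ ia) _; apply: s_homo; rewrite leq_maxr.
  exists n => i ia xi; apply: tn => //.
  have : [set i | bigodot_fun x i != \bot] i by [].
  by rewrite tE.
have [z zE] := bigodot_truncate x (s n); exists z => y /xsectionP/agreeP xy.
apply/gN/xsectionP/agreeP => i ig.
have zs : supp_below (s n) z by move=> j sj; rewrite zE ltNge sj.
have ia : i < a.
  apply: lt_le_trans ig _; apply: le_trans (gf _ _ zs) _.
  by apply: le_trans (s_le n.+1); rewrite /= le_max lexx orbT.
rewrite zE -xy //; case: ifP => // /negP nis.
by apply/esym/eqP/negPn/negP => /(xn _ ia).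
Qed.

Lemma open_cover_agree (V : set (set X)) : open_cover V ->
  exists a, forall x, exists2 A, V A & xsection (U a) x `<=` A.
Proof.
move=> [Vopen Vcov].
have /choice[N NP] x : exists A, V A /\ A x.
  by have : [set: X] x by []; rewrite -Vcov => -[A VA Ax]; exists A.
have [|a aN] := @uniform_refinement N.
  move=> x; have [VN Nx] := NP x.
  by apply: open_nbhs_nbhs; split; first exact: Vopen.
by exists a => x; have [z zN] := aN x; exists (N z) => //; have [] := NP z.
Qed.

Lemma bigodot_hausdorff : hausdorff_space X.
Proof.
move=> x y xy; apply: bigodot_inj => i; have [a ia] := exists_gt i.
have [z [/xsectionP/agreeP xz /xsectionP/agreeP yz]] :=
  xy _ _ (nbhs_section a x) (nbhs_section a y).
by rewrite xz // yz.
Qed.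

Lemma open_section a x : open (xsection (U a) x).
Proof.
rewrite openE => y /xsectionP xy; rewrite /interior nbhs_agree; exists a => //.
by move=> z /xsectionP yz; apply/xsectionP; exact: agree_trans yz.
Qed.

(** The balls of a fixed radius partition X into open sets, so each point has a
neighborhood meeting just one of them. *)
Lemma bigodot_paracompact : paracompact X.
Proof.
split=> [|V /open_cover_agree[a aV]]; first exact: bigodot_hausdorff.
exists [set xsection (U a) x | x in setT]; split.
- split; first by move=> _ [x _ <-]; exact: open_section.
  apply/seteqP; split=> // x _; exists (xsection (U a) x); first by exists x.
  exact/xsectionP/agree_refl.
- by move=> _ [x _ <-]; have [A VA xA] := aV x; exists A.
- move=> x; exists (xsection (U a) x); first exact: nbhs_section.
  apply: sub_finite_set (finite_set1 (xsection (U a) x)).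
  move=> _ [[y _ <-] [z [/xsectionP yz /xsectionP xz]]].
  have xy : U a (x, y) by apply: agree_trans xz (agree_sym yz).
  apply/seteqP; split=> w /xsectionP w'; apply/xsectionP.
    exact: agree_trans w'.
  exact: agree_trans (agree_sym xy) w'.
Qed.

(** Uniform refinement by the balls of radius 1/2 of a continuous pseudometric
yields one index that works at all points; conversely, each [agree lam a] is
the set where a two-valued pseudometric, locally constant hence continuous, is
less than 1. *)
Lemma universal_uniformity_agree (R : realType) :
  universal_uniformity R X = filter_from setT U.
Proof.
apply/seteqP; split => E.
  move=> [dist [[_ dist0 distC dist_tri] dist_cont] dE].
  have [|a aN] := @uniform_refinement (fun x => [set y | dist x y < 2^-1]%R).
    move=> x.
    have : \forall p \near ((x, x) : X * X), (dist p.1 p.2 < 2^-1)%R.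
      apply: (near_fun (fun p : X * X => dist p.1 p.2) (x, x)
        (fun r : R => (r < 2^-1)%R)); first exact: dist_cont.
      by apply: lt_nbhsl; rewrite /= dist0 invr_gt0.
    case=> -[A B] /= [Ax Bx] AB; apply: filterS Bx => y By.
    by apply: (AB (x, y)); split => //=; exact: nbhs_singleton.
  exists a => // -[x y] xy; apply: dE => /=; have [z zN] := aN x.
  have zx : (dist z x < 2^-1)%R by apply/zN/xsectionP/agree_refl.
  have zy : (dist z y < 2^-1)%R by apply/zN/xsectionP.
  apply: le_lt_trans (dist_tri x z y) _.
  by rewrite distC [ltRHS]splitr div1r ltrD.
move=> [a _ aE].
(* The two-valued pseudometric of the partition into balls of radius a. *)
pose dist x y : R := if `[< U a (x, y) >] then 0%R else 1%R.
have distE x y x' y' : U a (x, x') -> U a (y, y') -> dist x y = dist x' y'.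
  move=> xx' yy'; rewrite /dist; congr (if _ then _ else _).
  apply/asbool_equiv_eq; split=> [xy|xy'].
    exact: agree_trans (agree_trans (agree_sym xx') xy) yy'.
  exact: agree_trans (agree_trans xx' xy') (agree_sym yy').
exists dist; last first.
  move=> [x y] /=; rewrite /dist; case: asboolP => [xy _|]; first exact: aE.
  by rewrite ltxx.
have dist_ge0 x y : (0 <= dist x y)%R by rewrite /dist; case: ifP.
split; first split => //.
- by move=> x; rewrite /dist asboolT //; exact: agree_refl.
- move=> x y; rewrite /dist; congr (if _ then _ else _).
  by apply/asbool_equiv_eq; split; exact: agree_sym.
- move=> x y z; have [xy|nxy] := pselect (U a (x, y)).
    by rewrite (distE x z y z) ?lerDr //; exact: agree_refl.
  rewrite {2}/dist asboolF //; apply: (@le_trans _ _ 1%R).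
    by rewrite /dist; case: ifP.
  by rewrite lerDl.
- move=> [x y]; apply: (@near_cst_continuous _ _ (dist x y)).
  exists (xsection (U a) x, xsection (U a) y) => /=.
    by split; exact: nbhs_section.
  move=> [x' y'] [/= /xsectionP xx' /xsectionP yy'].
  by apply: distE; exact: agree_sym.
Qed.

(** * Domination in the product *)

Lemma universal_uniformity_equiv (R : realType) :
  poset_equiv (revincl (universal_uniformity R X)) K.
Proof.
rewrite universal_uniformity_agree.
apply: poset_equiv_filter_base => [a b|a b ab UaUb]; first exact: le_agree.
have [zero _] := exists_zero; have [y zy] := agree_strict zero ab.
by apply; exact: UaUb.
Qed.

Lemma nbhs_equiv x : poset_equiv K (revincl (nbhs x)).
Proof.
rewrite nbhs_agree; apply: poset_equiv_sym; apply: poset_equiv_filter_base.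
  by move=> a b ab; apply: le_xsection; exact: le_agree.
move=> a b ab UaUb; have [y xy] := agree_strict x ab.
by apply; apply/xsectionP/UaUb/xsectionP.
Qed.

(** The rank e x bounds the support of x, so that points of bounded rank form a
small set and one function of the rank can majorize all required radii. *)
Lemma fun_dominates_assignments :
  dominates (K -> K) (revincl (nbhd_assignments X)).
Proof.
have /choice[e eP] := exists_supp_below.
apply: (@dominates_to_revincl _ (K -> K) _ _
  (fun f => [set p | U (f (e p.1)) p])) => [f x|f g fg [x y]|N Nx].
- rewrite nbhs_agree; by exists (f (e x)).
- by apply: le_agree; have /asboolP := fg; exact.
- have /choice[g gN] x : exists a, xsection (U a) x `<=` xsection N x.
    by have := Nx x; rewrite nbhs_agree => -[a _ aN]; exists a.
  have [f gf] := supp_below_bound g; exists f => -[x y] /= xy.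
  by apply/xsectionP/gN/xsectionP; apply: le_agree xy; exact: gf.
Qed.

(** Given countably many assignments, their intersection N is an assignment, and
every permuted composition of copies of N lies below the corresponding
composition of the given assignments. *)
Lemma assignments_dominate_quasi_uniformity :
  dominates (revincl (nbhd_assignments X))
    (revincl (universal_quasi_uniformity X)).
Proof.
apply: (@dominates_to_revincl _ (revincl (nbhd_assignments X)) _ _
  (fun N => perm_product (fun=> val N))) => [N|N M /asboolP NM|E [N Nx NE]].
- by exists (fun=> val N) => // _; exact: set_mem (valP N).
- exact: sub_perm_product.
- have NX : nbhd_assignments X (\bigcap_n N n).
    move=> x; rewrite (_ : xsection _ x = \bigcap_n xsection (N n) x).
      by apply: nbhs_bigcap => n; exact: Nx.
    apply/seteqP; split=> y.
      by move=> /xsectionP xy n nn; apply/xsectionP; exact: xy.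
    by move=> xy; apply/xsectionP => n nn; apply/xsectionP; exact: xy.
  exists (exist _ (\bigcap_n N n) (mem_set NX)
    : revincl (nbhd_assignments X)); apply: subset_trans NE.
  by apply: sub_perm_product => n p; exact.
Qed.

(** The map reads off the radius at the points e i. To reach above q, choose an
element of the quasi-uniformity whose sections at the e i are balls of radius at
least q i; compositions would enlarge these sections, so the element is a
transitive relation. *)
Lemma quasi_uniformity_dominates_fun :
  dominates (revincl (universal_quasi_uniformity X)) (K -> K).
Proof.
have [zero zeroE] := exists_zero.
have /choice[e eP] i : exists x,
    bigodot_fun x i != \bot /\ forall j, j < i -> bigodot_fun x j = \bot.
  have [v vlam v0] := exists_nonzero i; have [x xE] := bigodot_update zero vlam.
  exists x; rewrite xE eqxx; split => // j ji; by rewrite lt_eqF // zeroE.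
apply: (@dominates_from_revincl _ (K -> K) _ _ (fun E i =>
  least [set a | xsection (U a) (e i) `<=` xsection E (e i)])).
  move=> E F _ [N Nx NF] FE; apply/asboolP => i; apply: le_least.
    have := Nx 0%N (e i); rewrite nbhs_agree => -[a _ aN]; exists a => y /= /aN.
    by move=> /xsectionP xy; apply/xsectionP/NF/perm_product_sub0.
  by move=> a /= aF; apply: subset_trans aF _; exact: le_xsection.
move=> q.
have /choice[h hP] i : exists a, i < a /\ q i <= a.
  have [a ia] := exists_gt i; exists (Order.max a (q i)).
  by rewrite lt_max ia le_max lexx orbT.
pose D i := xsection (U (h i)) (e i).
(* The index i is recovered from any point of D i as its first nonzero
coordinate, because h i > i. *)
have D_disj i j x : D i x -> D j x -> i = j.
  move=> /xsectionP/agreeP ix /xsectionP/agreeP jx.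
  have Dlt k l : (forall c, c < h k -> bigodot_fun (e k) c = bigodot_fun x c) ->
      (forall c, c < h l -> bigodot_fun (e l) c = bigodot_fun x c) -> ~ k < l.
    move=> kx lx kl; have [ek0 _] := eP k; have [_ /(_ _ kl) el0] := eP l.
    have [kh _] := hP k; have [lh _] := hP l.
    by move: ek0; rewrite kx // -lx ?el0 ?eqxx // (lt_trans kl).
  by case: (ltgtP i j) => // [/Dlt|/Dlt]; case.
(* The relation of staying in each D i: a preorder by construction. Its section
at a point of D i is D i by disjointness, and elsewhere the whole space. *)
pose E : set (X * X) := [set p | forall i, D i p.1 -> D i p.2].
have E_nbhs : nbhd_assignments X E.
  move=> x; rewrite nbhs_agree.
  have [[i Di]|nD] := pselect (exists i, D i x).
    exists (h i) => // y /xsectionP xy; apply/xsectionP => j /= Dj.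
    rewrite -(D_disj _ _ _ Di Dj); apply/xsectionP.
    by move/xsectionP : Di => ix; exact: agree_trans xy.
  exists \bot => // y _; apply/xsectionP => i /= Di.
  by case: nD; exists i.
have E_sub : perm_product (fun=> E) `<=` E.
  apply: perm_product_preorder => [[x y] /diagonalP-> //|[x z] [y /= xy yz] i].
  by move=> /xy/yz.
exists (perm_product (fun=> E)); first by exists (fun=> E).
apply/asboolP => i; have [_ qh] := hP i; apply: le_trans qh _.
rewrite leNgt; apply/negP => /(@agree_strict _ _ (e i))[y iy]; apply.
set P := [set a | _] in iy.
have /(_ y) : P (least P).
  apply: least_mem; have := E_nbhs (e i); rewrite nbhs_agree => -[a _ aE].
  exists a => z /aE /xsectionP iz; apply/xsectionP.
  exact: (@perm_product_sub0 _ (fun=> E)).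
move/xsectionP: iy => /[swap]/[apply] /xsectionP/E_sub /= /(_ i) Diy.
by apply/xsectionP/Diy; apply/xsectionP/agree_refl.
Qed.

End Bigodot.
End Regular.

Theorem theorem1p1 (R : realType) (d : Order.disp_t) (K : bOrderType d)
    (lam : K -> K)
    (K_regular : regular_cardinal K)
    (K_uncountable : ~ countable [set: K])
    (lam_cardinal : forall i, is_cardinal (lam i))
    (lam_gt1 : forall i, [set \bot] `<` seg (lam i)) :
  let X : topologicalType := bigodot lam in
  [/\ forall V : set (set X), open_cover V ->
        exists a : K, forall x : X,
          exists2 A, V A & xsection (agree lam a) x `<=` A,
      paracompact X /\
        universal_uniformity R X = filter_from [set: K] (agree lam),
      poset_equiv (revincl (universal_uniformity R X)) K /\
        forall x : X, poset_equiv K (revincl (nbhs x)) &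
      poset_equiv (revincl (nbhd_assignments X)) (K -> K) /\
        poset_equiv (K -> K) (revincl (universal_quasi_uniformity X))].
Proof.
have pq := assignments_dominate_quasi_uniformity K_regular K_uncountable lam.
have fp := fun_dominates_assignments K_regular K_uncountable lam.
have qf := quasi_uniformity_dominates_fun K_regular K_uncountable lam_gt1.
move=> X; split.
- exact: open_cover_agree.
- split; first exact: bigodot_paracompact.
  exact: universal_uniformity_agree.
- split=> [|x]; first exact: universal_uniformity_equiv.
  exact: nbhs_equiv.
- split; split=> //; first exact: dominates_trans pq qf.
  exact: dominates_trans fp pq.
Qed.
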